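(* Let $U$ be a pruned tree on $\omega$ and let $c:[U]\to(0;1)$ be continuous. Then there is a continuous function $\mathcal{H}_c:\mathrm{PrTr}_2\to\mathbf{K}$ such that for every $T\in\mathrm{PrTr}_2$: if $T\in\mathrm{WF}_2$ then $\mathcal{H}_c(T)$ is spongy, and if $T\in\mathrm{IF}_2$ then $\operatorname{ran}\mathcal{D}_{\mathcal{H}_c(T)}=\operatorname{ran}(c)\cup\{0,1\}$.
   Context: $2^{\omega}$ is the Cantor space; $N_s=\{x\in2^\omega:s\subset x\}$; $\mu$ is the coin-tossing measure, $\mu(N_s)=2^{-\mathrm{lh}(s)}$. For measurable $A$, $\mathcal{D}_A(z)=\lim_n\mu(A\cap N_{z\restriction n})/\mu(N_{z\restriction n})$ when it exists; $\operatorname{ran}\mathcal{D}_A$ is the set of values attained where defined. $A$ is spongy if there is some $z$ at which $\mathcal{D}_A(z)$ does not exist, while at every $z$ where it exists its value lies in $\{0,1\}$. A pruned tree on a set $I$ is a nonempty set of finite sequences from $I$ closed under initial segments in which every node has a proper extension; $[U]$ is its set of infinite branches with the product topology. $\mathrm{PrTr}_2$ is the Polish space of pruned trees on $\{0,1\}$ (subspace of $2^{(2^{<\omega})}$). $\mathcal{N}=\{y\in2^\omega:y(n)=1\text{ for infinitely many }n\}$; $\mathrm{WF}_2=\{T\in\mathrm{PrTr}_2:[T]\cap\mathcal{N}=\emptyset\}$, $\mathrm{IF}_2=\{T\in\mathrm{PrTr}_2:[T]\cap\mathcal{N}\ne\emptyset\}$. $\mathbf{K}$ is the space of compact subsets of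 $2^\omega$ with the Vietoris topology. *)

(* Defs.v *)
From HB Require Import structures.
From mathcomp Require Import all_boot all_order all_algebra.
From mathcomp Require Import all_classical all_reals all_analysis.
Set Implicit Arguments. Unset Strict Implicit. Unset Printing Implicit Defensive.
Import Order.TTheory GRing.Theory Num.Theory.
Import numFieldNormedType.Exports.
Local Open Scope classical_set_scope.
Local Open Scope ring_scope.

Definition baire_space : Type := {ptws nat -> nat}.
Definition tree_space : Type := {ptws seq bool -> bool}.

Definition restr {I : Type} (x : nat -> I) (n : nat) : seq I := mkseq x n.

Definition pruned_tree {I : Type} (U : set (seq I)) : Prop :=
  [/\ U !=set0,
      (forall s t : seq I, U (s ++ t) -> U s) &
      (forall s, U s -> exists t, t <> [::] /\ U (s ++ t))].

Definition body {I : Type} (U : set (seq I)) : set (nat -> I) :=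
  [set x | forall n, U (restr x n)].

Definition PrTr2 : set tree_space :=
  [set T : tree_space | pruned_tree [set s | T s]].

Definition infinitely_many_ones (y : nat -> bool) : Prop :=
  forall m, exists n, (m <= n)%N /\ y n.

Definition calN : set cantor_space := [set y | infinitely_many_ones y].

Definition WF2 : set tree_space :=
  [set T | PrTr2 T /\ body [set s | T s] `&` calN = set0].
Definition IF2 : set tree_space :=
  [set T | PrTr2 T /\ body [set s | T s] `&` calN !=set0].

Definition vietoris_subbasic (W : set (set cantor_space)) : Prop :=
  exists V : set cantor_space, open V /\
    (W = [set K | K `<=` V] \/ W = [set K | K `&` V !=set0]).

Definition continuous_PrTr2_to_K (H : tree_space -> set cantor_space) : Prop :=
  (forall T, PrTr2 T -> compact (H T)) /\
  (forall W, vietoris_subbasic W ->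
     exists O : set tree_space, open O /\ O `&` PrTr2 = (H @^-1` W) `&` PrTr2).

(** Coin-tossing measure, realised as the image of Lebesgue measure under
    the binary-expansion map 2^omega -> [0,1] (injective off a countable set,
    so mu A = lambda(bin_val(A)) for Borel A). *)
Section Measure.
Variable R : realType.

Definition bin_val (y : cantor_space) : R :=
  limn (fun n : nat => \sum_(k < n) ((y k)%:R / 2 ^+ k.+1 : R)).

Definition mu (A : set cantor_space) : R :=
  fine (@lebesgue_measure R (bin_val @` A)).

Definition cyl (s : seq bool) : set cantor_space :=
  [set x | restr x (size s) = s].

Definition density_is (A : set cantor_space) (z : cantor_space) (l : R) : Prop :=
  (fun n => mu (A `&` cyl (restr z n)) / mu (cyl (restr z n))) @ \oo --> l.

Definition ran_density (A : set cantor_space) : set R :=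
  [set l | exists z, density_is A z l].

Definition spongy (A : set cantor_space) : Prop :=
  (exists z, ~ exists l, density_is A z l) /\
  (forall z l, density_is A z l -> l = 0 \/ l = 1).
End Measure.

(* Main.v *)
Require Import Defs.
From HB Require Import structures.
From mathcomp Require Import all_boot all_order all_algebra.
From mathcomp Require Import all_classical all_reals all_analysis.
From mathcomp Require Import ring lra.
Import Order.TTheory GRing.Theory Num.Theory.
Import numFieldNormedType.Exports.
Local Open Scope classical_set_scope.
Local Open Scope ring_scope.
Set Implicit Arguments. Unset Strict Implicit. Unset Printing Implicit Defensive.

(** The relative measure of a closed set [K] in the cylinder of [s] is a
    [0,1]-valued martingale in [s], and conversely a martingale [d] for which
    almost every branch is eventually 0 or 1 is the relative measure of the closed
    set of points along which [d] stays positive.  We prescribe [d] by a machine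
    reading the digits of a point, two at a time: the first digit is free and is
    appended to a word [w], the second is 0 as long as the machine keeps going.
    In this last step [d] moves from [p] as close to a target [tau w] as the
    martingale constraint permits (within [min(p, 1 - p)] of [p]), and the sibling
    absorbs the difference; from there on [d] always moves by the full amount
    [min(p, 1 - p)].  Full moves do not tend to 0 at any limit in (0,1), so a
    density in (0,1) can only occur at a point that keeps going, and it is then the
    limit of the targets; conversely [d] follows targets converging in (0,1).

    Finally [w] is read as a pair [(y, v)], with [v] coding a point [x] of Baire
    space.  If [k] is the largest number such that the known part of [y] lies in
    [T] and has at least [k] ones, and [x|k] is known and lies in [U], then the target
    alternates between [a] and [a (1 - 1/(k+2))], where [a] is the value of [c] at
    a branch of [U] through [x|k].  The targets converge to a positive number
    exactly when [k] tends to infinity, that is, when [y] is in [[T]], has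
    infinitely many ones and [x] is in [[U]], and then the limit is [c x]. *)

(** * Cylinders *)

Lemma size_restr (I : Type) (x : nat -> I) n : size (restr x n) = n.
Proof. by rewrite /restr size_mkseq. Qed.

Lemma restrS (I : Type) (x : nat -> I) n : restr x n.+1 = rcons (restr x n) (x n).
Proof. by rewrite /restr /mkseq -addn1 iotaD map_cat cats1 add0n. Qed.

Lemma restr_take (I : Type) (x : nat -> I) m n : (m <= n)%N -> take m (restr x n) = restr x m.
Proof. by move=> mn; rewrite /restr /mkseq -map_take take_iota (minn_idPl mn). Qed.

Lemma restr_le (I : Type) (x y : nat -> I) m n : (m <= n)%N ->
  restr x n = restr y n -> restr x m = restr y m.
Proof. by move=> mn e; rewrite -(restr_take x mn) -(restr_take y mn) e. Qed.

Lemma restr_eqP (I : eqType) (x y : nat -> I) n :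
  restr x n = restr y n <-> forall i, (i < n)%N -> x i = y i.
Proof.
split=> [e i ilt|e]; last by apply/eq_in_map => i; rewrite mem_iota add0n => /andP[_ /e].
have := f_equal (fun s => nth (x 0%N) s i) e.
by rewrite /restr !nth_mkseq.
Qed.

Section Cylinders.
Implicit Types (s : seq bool) (y : cantor_space).

Lemma cyl_rcons s b y : cyl (rcons s b) y <-> cyl s y /\ y (size s) = b.
Proof.
rewrite /cyl /= size_rcons restrS; split=> [/rcons_inj[]//|[-> ->//]].
Qed.

Lemma cyl_split (A : set cantor_space) s :
  A `&` cyl s = (A `&` cyl (rcons s false)) `|` (A `&` cyl (rcons s true)).
Proof.
apply/seteqP; split=> [y [Ay sy]|y].
- case e : (y (size s)); [right|left]; split=> //; exact/cyl_rcons.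
- by case=> -[Ay /cyl_rcons[]].
Qed.

Lemma near_coord (I : eqType) (i : I) (T : {ptws I -> bool}) :
  \forall T' \near T, T' i = T i.
Proof.
have := @proj_continuous I (fun=> bool) i T [set T i].
apply. exact: discrete_set1.
Qed.

Lemma near_restr y n : \forall y' \near y, restr y' n = restr y n.
Proof.
elim: n => [|n IH]; first exact: filterE.
by apply: filterS2 IH (near_coord n y) => y' e e'; rewrite !restrS e e'.
Qed.

Lemma nbhs_cyl y n : nbhs y (cyl (restr y n)).
Proof. by rewrite /cyl /= size_restr; exact: near_restr. Qed.

Lemma cyl_closed s : closed (cyl s).
Proof.
move=> y /(_ _ (near_restr y (size s)))[y' [sy' e]].
exact: etrans (esym e) sy'.
Qed.

End Cylinders.


(** Agreement on ever longer prefixes generates a filter that converges to [x] in each coordinate,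
    points of [D] being open; it therefore refines the neighbourhoods of [x] in the product
    topology. *)
Lemma nbhs_restr (D : uniformType) (x : {ptws nat -> D}) (V : set {ptws nat -> D}) :
  (forall d : D, nbhs d [set d]) -> nbhs x V ->
  exists n, forall x' : nat -> D, restr x' n = restr x n -> V x'.
Proof.
move=> dD nV.
pose F := filter_from [set: nat] (fun n => [set x' : {ptws nat -> D} | restr x' n = restr x n]).
have FF : Filter F.
  apply: filter_from_filter; first by exists 0%N.
  move=> i j _ _; exists (maxn i j) => // x' /= e.
  by split; apply: restr_le e; rewrite ?leq_maxl ?leq_maxr.
have /pointwise_cvgP : forall t : nat, g t @[g --> F] --> x t.
  move=> t W /= nW; exists t.+1 => // x' /= e.
  have -> : x' t = x t.
    have := f_equal (fun s => nth (x t) s t) e.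
    by rewrite /restr !nth_mkseq.
  exact: nbhs_singleton.
by move=> /(_ V nV)[n _ nV']; exists n.
Qed.

(** * The coin-tossing measure *)

Section BinVal.
Variable R : realType.
Implicit Types (x y : cantor_space) (s : seq bool) (A : set cantor_space).

Definition bin_sum y n : R := \sum_(k < n) ((y k)%:R / 2 ^+ k.+1).

Lemma bin_sumS y n : bin_sum y n.+1 = bin_sum y n + (y n)%:R / 2 ^+ n.+1.
Proof. by rewrite /bin_sum big_ord_recr. Qed.

Lemma eq_bin_sum x y n : restr x n = restr y n -> bin_sum x n = bin_sum y n.
Proof. by move=> /restr_eqP e; apply: eq_bigr => i _; rewrite e. Qed.

Lemma half_exprS n : 2 ^- n.+1 = 2 ^- n / 2 :> R.
Proof. by rewrite exprS invfM mulrC. Qed.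

Lemma bin_sum_le y m n : (m <= n)%N -> bin_sum y m <= bin_sum y n.
Proof.
apply: (homo_leq (@lexx _ R) (fun _ _ _ => @le_trans _ R _ _ _)) => k.
by rewrite bin_sumS lerDl divr_ge0// exprn_ge0.
Qed.

Lemma bin_sum_ge y m n : (m <= n)%N -> bin_sum y n + 2 ^- n <= bin_sum y m + 2 ^- m.
Proof.
apply: (homo_leq (r := fun a b => b <= a) (f := fun n => bin_sum y n + 2 ^- n)) => //.
- by move=> a b c h1 h2; exact: le_trans h2 h1.
- move=> k; rewrite bin_sumS half_exprS -addrA lerD2l.
  have : (y k)%:R <= 1 :> R by case: (y k).
  have : 0 < 2 ^- k :> R by rewrite invr_gt0 exprn_gt0.
  by move: (2 ^- k) => t t0 h; nra.
Qed.

Lemma bin_sum_cvg y : bin_sum y @ \oo --> bin_val R y.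
Proof.
apply: nondecreasing_is_cvgn; first by move=> m n; exact: bin_sum_le.
exists 1 => _ [n _ <-].
have := bin_sum_ge y (leq0n n); rewrite {2}/bin_sum big_ord0 add0r expr0 invr1.
by apply: le_trans; rewrite lerDl invr_ge0 exprn_ge0.
Qed.

Lemma bin_val_bounds y n : bin_sum y n <= bin_val R y <= bin_sum y n + 2 ^- n.
Proof.
have cv := @bin_sum_cvg y.
have lim := cvg_lim (@Rhausdorff R) cv.
apply/andP; split; rewrite -lim.
- apply: limr_ge; first by apply/cvg_ex; exists (bin_val R y).
  by exists n => // k /= nk; exact: bin_sum_le.
- apply: limr_le; first by apply/cvg_ex; exists (bin_val R y).
  exists n => // k /= nk; apply: le_trans (bin_sum_ge y nk).
  by rewrite lerDl invr_ge0 exprn_ge0.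
Qed.

Lemma bin_val_continuous : continuous (bin_val R).
Proof.
move=> y; apply/cvgrPdist_lt => e e0.
have [n ne] : exists n, 2 ^- n < e.
  have [n _ /(_ n (leqnn n))] := near_infty_natSinv_expn_lt (PosNum e0).
  by rewrite div1r; exists n.
apply: filterS (near_restr y n) => x xy.
have /andP[x1 x2] := bin_val_bounds x n; have /andP[y1 y2] := bin_val_bounds y n.
rewrite (eq_bin_sum xy) in x1 x2.
apply: le_lt_trans ne; rewrite ler_norml; apply/andP; split; lra.
Qed.

Lemma closed_compact A : closed A -> compact A.
Proof. by move=> cA; apply: subclosed_compact cantor_space_compact _. Qed.

Lemma bin_val_closed A : closed A -> closed (bin_val R @` A).
Proof.
move=> cA; apply: compact_closed; first exact: Rhausdorff.
apply: continuous_compact; last exact: closed_compact.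
by apply: continuous_subspaceT => y; exact: bin_val_continuous.
Qed.

Lemma bin_val_measurable A : closed A ->
  measurable (bin_val R @` A : set (measurableTypeR R)).
Proof. by move=> cA; apply: measurable_realfun.closed_measurable; exact: bin_val_closed. Qed.

(** Orbit of [r] under the doubling map, with the digit removed at each step. The value 1 is fixed,
    so remainders stay in the closed unit interval. *)
Fixpoint binary_rem (r : R) n : R :=
  if n is n'.+1 then 2 * binary_rem r n' - (1 <= 2 * binary_rem r n')%R%:R else r.

Lemma bin_val_surj (r : R) : 0 <= r <= 1 -> exists y, bin_val R y = r.
Proof.
move=> r01; pose y : cantor_space := fun n => 1 <= 2 * binary_rem r n.
have rem01 n : 0 <= binary_rem r n <= 1.
  elim: n => [//|n /andP[h1 h2]] /=.
  by case: (leP 1 (2 * binary_rem r n)) => h /=; apply/andP; split; lra.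
have sumE n : bin_sum y n = r - binary_rem r n * 2 ^- n.
  elim: n => [|n IH]; first by rewrite /bin_sum big_ord0 /= expr0 invr1; lra.
  by rewrite bin_sumS IH half_exprS /=; lra.
exists y; apply: cvg_lim; first exact: Rhausdorff.
have half0 : (fun n => 2 ^- n : R) @ \oo --> (0 : R).
  rewrite (_ : (fun n => _) = GRing.exp (2^-1 : R)).
    by apply: cvg_expr; rewrite ger0_norm ?invr_ge0// invf_lt1// ltr1n.
  by apply/funext => n; rewrite exprVn.
have rhalf : (fun n => r - 2 ^- n : R) @ \oo --> r.
  by rewrite -[X in _ --> X]subr0; apply: cvgB => //; exact: cvg_cst.
apply: squeeze_cvgr rhalf (cvg_cst r).
apply: nearW => n; rewrite -/(bin_sum y n) sumE; have /andP[h1 h2] := rem01 n.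
have : 0 < 2 ^- n :> R by rewrite invr_gt0 exprn_gt0.
by move: (2 ^- n) => t t0; apply/andP; split; rewrite /cst; nra.
Qed.

Lemma cyl_nth s : cyl s (nth false s).
Proof.
by apply: (@eq_from_nth _ false); rewrite size_restr// => i il; rewrite nth_mkseq.
Qed.

Lemma bin_val_cyl s y : cyl s y ->
  bin_sum (nth false s) (size s) <= bin_val R y
    <= bin_sum (nth false s) (size s) + 2 ^- size s.
Proof.
move=> sy; rewrite -(@eq_bin_sum y) ?bin_val_bounds//.
by rewrite sy (cyl_nth s).
Qed.

(** The separating value is the midpoint of the dyadic interval of [s]. *)
Lemma bin_val_cyl_children s : exists a : R,
  (forall y, cyl (rcons s false) y -> bin_val R y <= a) /\
  (forall y, cyl (rcons s true) y -> a <= bin_val R y).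
Proof.
exists (bin_sum (nth false s) (size s) + 2 ^- (size s).+1).
have E y : cyl s y -> bin_sum y (size s).+1 =
    bin_sum (nth false s) (size s) + (y (size s))%:R / 2 ^+ (size s).+1.
  by move=> sy; rewrite bin_sumS (@eq_bin_sum y (nth false s))// sy (cyl_nth s).
split=> y /cyl_rcons[/E sE yb]; have /andP[] := bin_val_bounds y (size s).+1;
  rewrite sE yb.
- by move=> _; rewrite mul0r addr0.
- by rewrite div1r.
Qed.

End BinVal.

Section CoinMeasure.
Variable R : realType.
Implicit Types (x y : cantor_space) (s : seq bool) (A : set cantor_space).
Local Notation lam := (@lebesgue_measure R).

Lemma bin_val_itv y : 0 <= bin_val R y <= 1.
Proof.
have := bin_val_bounds R y 0; rewrite /bin_sum big_ord0 expr0 invr1 add0r.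
exact.
Qed.

Lemma lebesgue_image_lty A : closed A -> (lam (bin_val R @` A) < +oo)%E.
Proof.
move=> cA; apply: (@le_lt_trans _ _ (lam `[0, 1]%classic)); last first.
  by rewrite lebesgue_measure_itv /= lte_fin ltr01 ltry.
apply: le_measure; rewrite ?inE//; first exact: bin_val_measurable.
by move=> _ [y _ <-] /=; rewrite in_itv /= bin_val_itv.
Qed.

Lemma mu_EFin A : closed A -> lam (bin_val R @` A) = (mu R A)%:E.
Proof.
move=> cA; rewrite /mu fineK// ge0_fin_numE//; exact: lebesgue_image_lty.
Qed.

Lemma mu_ge0 A : 0 <= mu R A.
Proof. by rewrite /mu fine_ge0. Qed.

Lemma mu_le A B : closed A -> closed B -> A `<=` B -> mu R A <= mu R B.
Proof.
move=> cA cB AB; rewrite -lee_fin -!mu_EFin//.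
apply: le_measure; rewrite ?inE; [exact: bin_val_measurable..|].
exact: image_subset.
Qed.

Lemma mu_set0 : mu R set0 = 0.
Proof. by rewrite /mu image_set0 measure0. Qed.

(** [bin_val] is not injective, but the images of the two halves overlap in at most the dyadic
    midpoint, a Lebesgue null set. *)
Lemma mu_split A s : closed A ->
  mu R (A `&` cyl s) = mu R (A `&` cyl (rcons s false)) + mu R (A `&` cyl (rcons s true)).
Proof.
move=> cA.
have cl t : closed (A `&` cyl t) by apply: closedI => //; exact: cyl_closed.
apply: EFin_inj; rewrite EFinD -!mu_EFin// cyl_split image_setU.
rewrite measureUfinl; [|exact: bin_val_measurable..|exact: lebesgue_image_lty].
set I := (X in (_ - lam X)%E); suff -> : lam I = 0%E by rewrite sube0.
have [a [a0 a1]] := bin_val_cyl_children R s.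
apply/eqP; rewrite eq_le measure_ge0 andbT -[leRHS](lebesgue_measure_set1 a).
apply: le_measure; rewrite ?inE//.
  by apply: measurableI; exact: bin_val_measurable.
move=> r [[x [_ x0] xr] [y [_ y1] yr]] /=.
apply/eqP; rewrite eq_le -{1}xr -yr.
by rewrite a0// a1.
Qed.

Lemma mu_cyl_le s : mu R (cyl s) <= 2 ^- size s.
Proof.
have cs := @cyl_closed s.
rewrite -lee_fin -mu_EFin//.
set a := bin_sum R (nth false s) (size s).
have h : 0 < 2 ^- size s :> R by rewrite invr_gt0 exprn_gt0.
apply: (@le_trans _ _ (lam `[a, a + 2 ^- size s]%classic)).
  apply: le_measure; rewrite ?inE//; first exact: bin_val_measurable.
  by move=> _ [y /(bin_val_cyl R) sy <-] /=; rewrite in_itv.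
by rewrite lebesgue_measure_itv /= lte_fin ltrDl h -EFinD addrAC subrr add0r.
Qed.

Lemma mu_setT : mu R setT = 1.
Proof.
apply: EFin_inj; rewrite -mu_EFin; last exact: closedT.
rewrite (_ : bin_val R @` setT = `[0, 1]%classic).
  by rewrite lebesgue_measure_itv /= lte_fin ltr01 -EFinD subr0.
apply/seteqP; split=> [_ [y _ <-]|r] /=; rewrite in_itv /= ?bin_val_itv//.
by move=> /bin_val_surj[y <-]; exists y.
Qed.

(** Both children obey the bound [mu_cyl_le] and their masses add up to that of the parent, which
    forces equality. *)
Lemma mu_cyl s : mu R (cyl s) = 2 ^- size s.
Proof.
elim/last_ind: s => [|s b IH].
  rewrite (_ : cyl [::] = setT) ?mu_setT ?expr0 ?invr1//.
  by apply/seteqP; split.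
have := @mu_split setT s closedT; rewrite !setTI IH.
have := mu_cyl_le (rcons s false); have := mu_cyl_le (rcons s true).
rewrite !size_rcons half_exprS; case: b; move=> *; lra.
Qed.

Definition rel_meas A s : R := mu R (A `&` cyl s) / mu R (cyl s).

Let mu_cyl_gt0 s : 0 < mu R (cyl s).
Proof. by rewrite mu_cyl invr_gt0 exprn_gt0. Qed.

Lemma rel_meas_split A s : closed A ->
  rel_meas A (rcons s false) + rel_meas A (rcons s true) = 2 * rel_meas A s.
Proof.
move=> cA; rewrite /rel_meas (mu_split s cA) !mu_cyl !size_rcons half_exprS.
have := mu_cyl_gt0 s; rewrite mu_cyl.
by move: (2 ^- size s) => t t0; field; rewrite gt_eqF.
Qed.

Lemma rel_meas_bounds A s : closed A -> 0 <= rel_meas A s <= 1.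
Proof.
move=> cA; apply/andP; split; first by rewrite divr_ge0// mu_ge0.
rewrite ler_pdivrMr// mul1r; apply: mu_le; [|exact: cyl_closed|exact: subIsetr].
by apply: closedI => //; exact: cyl_closed.
Qed.

Lemma rel_meas_sub A s : cyl s `<=` A -> rel_meas A s = 1.
Proof. by move=> /setIidr sA; rewrite /rel_meas sA divff// gt_eqF. Qed.

Lemma rel_meas_disjoint A s : A `&` cyl s = set0 -> rel_meas A s = 0.
Proof. by rewrite /rel_meas => ->; rewrite mu_set0 mul0r. Qed.

(** By compactness: if every point over [r] leaves some [F n], then a single [n] serves all of them,
    and [r] is not in the image of that [F n]. *)
Lemma image_bigcap_nonincreasing (F : nat -> set cantor_space) :
  (forall n, closed (F n)) -> (forall m n, (m <= n)%N -> F n `<=` F m) ->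
  bin_val R @` (\bigcap_n F n) = \bigcap_n (bin_val R @` F n).
Proof.
move=> cF dF; apply/seteqP; split=> [_ [y yF <-] n _|r rF].
  by exists y => //; exact: yF.
apply: contrapT => nr.
have /compact_near_coveringP := cantor_space_compact.
move=> /(_ nat \oo (fun n x => ~ (F n x /\ bin_val R x = r)) _).
case.
- move=> x _; case: (pselect (bin_val R x = r)) => [xr|/eqP xr].
  + have [n nFx] : exists n, ~ F n x.
      by apply/existsNP => Fx; apply: nr; exists x => // n _; exact: Fx.
    have nbx : nbhs x (~` F n) by apply: open_nbhs_nbhs; split=> //; apply: closed_openC.
    exists (~` F n, [set k | (n <= k)%N]); first by split=> //=; exists n.
    by move=> [y k] /= [nFy nk] [Fky _]; apply: nFy; exact: dF nk _ Fky.
  + have nbx : nbhs x (bin_val R @^-1` [set t | t != r]).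
      apply: (@bin_val_continuous R x [set t | t != r]).
      by apply: open_nbhs_nbhs; split=> //; exact: open_neq.
    exists (bin_val R @^-1` [set t | t != r], setT); first by split=> //; exact: filterT.
    by move=> [y k] /= [/eqP yr _] [_ /yr].
move=> n _ /(_ n (leqnn n)) nF.
by have [y Fy yr] := rF n I; exact: (nF y I).
Qed.

Lemma mu_bigcap_ge (F : nat -> set cantor_space) (r : R) :
  (forall n, closed (F n)) -> (forall m n, (m <= n)%N -> F n `<=` F m) ->
  (forall n, r <= mu R (F n)) -> r <= mu R (\bigcap_n F n).
Proof.
move=> cF dF rF.
have cI : closed (\bigcap_n F n) by apply: closed_bigI.
have mI := @bin_val_measurable R _ cI.
rewrite -lee_fin -mu_EFin// image_bigcap_nonincreasing//.
rewrite image_bigcap_nonincreasing// in mI.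
have cv : lam \o (fun n => bin_val R @` F n) @ \oo --> lam (\bigcap_n (bin_val R @` F n)).
  apply: nonincreasing_cvg_mu => //.
  - exact: lebesgue_image_lty.
  - by move=> n; exact: bin_val_measurable.
  - by move=> m n mn; apply/subsetPset; apply: image_subset; exact: dF.
rewrite -(cvg_lim _ cv)//; apply: lime_ge; first by apply/cvg_ex; eexists; exact: cv.
by apply: nearW => n /=; rewrite mu_EFin// lee_fin.
Qed.

End CoinMeasure.

(** * Closed sets with a prescribed relative measure *)

Section Martingale.
Variables (R : realType) (d : seq bool -> R).
Hypothesis d01 : forall s, 0 <= d s <= 1.
Hypothesis d_split : forall s, d (rcons s false) + d (rcons s true) = 2 * d s.
Implicit Types (s : seq bool) (z : cantor_space).

Definition positive_set : set cantor_space := [set z | forall n, 0 < d (restr z n)].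

Definition positive_level n : set cantor_space := [set z | 0 < d (restr z n)].

Lemma martingale_pos_parent s b : 0 < d (rcons s b) -> 0 < d s.
Proof.
have := d_split s; have /andP[? _] := d01 (rcons s true).
by have /andP[? _] := d01 (rcons s false); case: b => *; lra.
Qed.

Lemma positive_level_nonincreasing m n : (m <= n)%N -> positive_level n `<=` positive_level m.
Proof.
move=> mn z; rewrite /positive_level /=; elim: n mn => [|n IH].
  by rewrite leqn0 => /eqP ->.
rewrite leq_eqVlt => /orP[/eqP -> //|mn].
by rewrite restrS => /martingale_pos_parent; exact: IH.
Qed.

Lemma positive_setE : positive_set = \bigcap_n positive_level n.
Proof. by apply/seteqP; split=> [z Kz n _|z Kz n]; [exact: Kz|exact: Kz n I]. Qed.

Lemma positive_level_closed n : closed (positive_level n).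
Proof.
move=> z /(_ _ (near_restr z n))[y []]; rewrite /positive_level /=.
by move=> + e; rewrite e.
Qed.

Lemma positive_set_closed : closed positive_set.
Proof.
by rewrite positive_setE; apply: closed_bigI => n _; exact: positive_level_closed.
Qed.

(** From depth [n] on, a node with [d] positive has its whole cylinder in the level set; above that
    depth, both sides are averages over the two children. *)
Lemma rel_meas_level_ge n s : d s <= rel_meas R (positive_level n) s.
Proof.
(* The induction is on a bound for the number of digits that [s] lacks to reach depth [n]. *)
have : (n <= size s + n)%N by exact: leq_addl.
elim: {2}n s => [|k IH] s.
  rewrite addn0 => ns; have /andP[d0 d1] := d01 s.
  move: d0; rewrite le_eqVlt => /orP[/eqP <-|d0].
    by have /andP[] := rel_meas_bounds R s (@positive_level_closed n).
  rewrite rel_meas_sub// => z sz; apply: (positive_level_nonincreasing ns).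
  by rewrite /positive_level /= sz.
move=> ns; have := d_split s; have := rel_meas_split R s (@positive_level_closed n).
have := IH (rcons s false); have := IH (rcons s true).
by rewrite !size_rcons !addSnnS => /(_ ns) ? /(_ ns) ? ? ?; lra.
Qed.

(** The bound for each level passes to the intersection by continuity of the measure from above. *)
Lemma rel_meas_positive_ge s : d s <= rel_meas R positive_set s.
Proof.
have c0 : 0 < mu R (cyl s) by rewrite mu_cyl invr_gt0 exprn_gt0.
rewrite /rel_meas ler_pdivlMr// positive_setE.
rewrite -bigcapIl; last by exists 0%N.
apply: mu_bigcap_ge => [n|m n mn|n].
- by apply: closedI; [exact: positive_level_closed|exact: cyl_closed].
- by apply: setSI; exact: positive_level_nonincreasing.
- by rewrite -ler_pdivlMr//; exact: rel_meas_level_ge.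
Qed.

(* A nonnegative martingale; [d] is the relative measure as soon as it vanishes at the root. *)
Definition excess s : R := rel_meas R positive_set s - d s.

Lemma excess_ge0 s : 0 <= excess s.
Proof. by rewrite subr_ge0 rel_meas_positive_ge. Qed.

Lemma excess_le1 s : excess s <= 1.
Proof.
have /andP[_ ?] := rel_meas_bounds R s positive_set_closed.
by have /andP[? _] := d01 s; rewrite /excess; lra.
Qed.

Lemma excess_split s : excess (rcons s false) + excess (rcons s true) = 2 * excess s.
Proof.
have := d_split s; have := rel_meas_split R s positive_set_closed.
by rewrite /excess; lra.
Qed.

(** At value 0 the cylinder misses the positive set; at value 1 the relative measure has no room
    above [d]. *)
Lemma excess_extreme s : d s = 0 \/ d s = 1 -> excess s = 0.
Proof.
move=> ds; apply/eqP; rewrite eq_le excess_ge0 andbT /excess.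
case: ds => ds.
  rewrite rel_meas_disjoint ?ds ?subr0//.
  apply/seteqP; split=> // z [/(_ (size s))] + sz.
  by rewrite sz ds ltxx.
by rewrite ds subr_le0; have /andP[] := rel_meas_bounds R s positive_set_closed.
Qed.

Lemma rel_meas_positive : excess [::] = 0 -> forall s, rel_meas R positive_set s = d s.
Proof.
move=> e0 s; apply/eqP; rewrite -subr_eq0 -/(excess s); apply/eqP.
elim/last_ind: s => [//|s b IH].
have := excess_split s; rewrite IH.
have := excess_ge0 (rcons s false); have := excess_ge0 (rcons s true).
by case: b; lra.
Qed.

End Martingale.

(** * The machine and the relative measure of the set it defines *)

Section Process.
Variables (R : realType) (tau : seq bool -> R).
Hypothesis tau01 : forall w, 0 < tau w < 1.
Implicit Types (s w : seq bool) (z : cantor_space) (p t : R).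

(** The real number is the current density. [Decide] awaits a free digit, [Move] the digit that says
    whether to keep going, and [Leaf] makes full moves forever. *)
Inductive state : Type :=
  | Leaf of R
  | Decide of R & seq bool
  | Move of R & seq bool.

Definition state_val (x : state) : R :=
  match x with Leaf p => p | Decide p _ => p | Move p _ => p end.

(** The largest [r] for which both [p - r] and [p + r] are in the unit interval. *)
Definition radius p : R := Num.min p (1 - p).

(** The point nearest to [t] among those within the radius of [p]. *)
Definition step p t : R := Num.max (p - radius p) (Num.min (p + radius p) t).

Definition next (x : state) (b : bool) : state :=
  match x with
  | Leaf p => Leaf (if b then p - radius p else p + radius p)
  | Decide p w => Move p (rcons w b)
  | Move p w => if b then Leaf (2 * p - step p (tau w)) else Decide (step p (tau w)) w
  end.

Definition run s : state := foldl next (Decide (1 / 2) [::]) s.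

Definition dens s : R := state_val (run s).

Lemma run_rcons s b : run (rcons s b) = next (run s) b.
Proof. by rewrite /run foldl_rcons. Qed.

Lemma step_bounds p t : 0 < p < 1 -> 0 < t < 1 -> 0 < step p t < 1.
Proof.
move=> /andP[? ?] /andP[? ?]; rewrite /step /radius.
have := erefl (Num.min p (1 - p)); rewrite {2}/Num.min; move: (Num.min _ _) => r.
by case: ltP => ? ->; case: (leP (_ + _) t) => ?; case: (leP (p - _)) => ?; apply/andP; split; lra.
Qed.

Lemma step_radius p t : 0 < p < 1 -> `|step p t - p| <= radius p.
Proof.
move=> /andP[? ?]; rewrite /step /radius ler_norml.
have := erefl (Num.min p (1 - p)); rewrite {2}/Num.min; move: (Num.min _ _) => r.
by case: ltP => ? ->; case: (leP (_ + _) t) => ?; case: (leP (p - _)) => ?; apply/andP; split; lra.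
Qed.

Lemma step_target p t : `|step p t - p| < radius p -> step p t = t.
Proof.
rewrite /step ltr_norml => /andP[]; move: (radius p) => r.
by case: (leP (p + r) t) => ?; case: (leP (p - r)) => ? ? ?; lra.
Qed.

Lemma step_between p t a b : a <= p <= b -> a <= t <= b -> 0 <= radius p ->
  a <= step p t <= b.
Proof.
rewrite /step; move: (radius p) => r /andP[? ?] /andP[? ?] ?.
by case: (leP (p + r) t) => ?; case: (leP (p - r)) => ?; apply/andP; split; lra.
Qed.

Definition valid_state (x : state) : Prop :=
  match x with
  | Leaf p => 0 <= p <= 1
  | Decide p _ => 0 < p < 1
  | Move p _ => 0 < p < 1
  end.

Lemma run_valid s : valid_state (run s).
Proof.
elim/last_ind: s => [|s b]; first by rewrite /=; apply/andP; split; lra.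
rewrite run_rcons; case: (run s) => [p|p w|p w] //=.
  move=> /andP[? ?]; rewrite /radius.
  by case: b; case: (leP p (1 - p)) => ?; apply/andP; split; lra.
move=> p01; case: b => /=; last exact: step_bounds.
(* The sibling density is the reflection of the step in [p], so it too is within the radius of
   [p]. *)
have := step_radius (tau w) p01; move: p01 => /andP[? ?].
rewrite ler_norml /radius; move: (step p (tau w)) => q.
by case: (leP p (1 - p)) => ? /andP[? ?]; apply/andP; split; lra.
Qed.

Lemma dens01 s : 0 <= dens s <= 1.
Proof.
have := run_valid s; rewrite /dens; case: (run s) => [p|p w|p w] //= /andP[? ?];
by apply/andP; split; lra.
Qed.

Lemma dens_split s : dens (rcons s false) + dens (rcons s true) = 2 * dens s.
Proof. by rewrite /dens !run_rcons; case: (run s) => [p|p w|p w] /=; lra. Qed.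

Local Notation G := (excess dens).

(* One of the two children of a leaf has density 0 or 1, hence no excess: the excess doubles
   along the other one while staying bounded by 1. *)
Lemma excess_leaf s p n : run s = Leaf p -> G s <= 2 ^- n.
Proof.
elim: n s p => [|n IH] s p sp.
  by rewrite expr0 invr1 (excess_le1 dens01).
have := excess_split dens_split s.
have r0 := run_rcons s false; have r1 := run_rcons s true.
have := IH _ _ (etrans r0 (f_equal (next^~ false) sp)).
have := IH _ _ (etrans r1 (f_equal (next^~ true) sp)).
have ext b : (state_val (next (Leaf p) b) = 0 \/ state_val (next (Leaf p) b) = 1) ->
    G (rcons s b) = 0.
  by move=> h; apply: (excess_extreme dens01 dens_split); rewrite /dens run_rcons sp.
rewrite half_exprS; case: (leP p (1 - p)) => h.
  have := ext true; rewrite /= /radius (min_idPl h) subrr => -> //; last by left.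
  by move: (G _) (G _) => *; lra.
have := ext false; rewrite /= /radius (min_idPr (ltW h)) => ->; last by right; lra.
by move: (G _) (G _) => *; lra.
Qed.

Lemma excess_leaf0 s p : run s = Leaf p -> G s = 0.
Proof.
move=> sp; apply/eqP; rewrite eq_le (excess_ge0 dens01 dens_split) andbT leNgt.
apply/negP => g0.
have [n _ /(_ n (leqnn n))] := near_infty_natSinv_expn_lt (PosNum g0).
by rewrite /= div1r ltNge (excess_leaf n sp).
Qed.

(** Each round halves the bound: a [Move] node has a leaf child without excess, so its excess is
    half that of its [Decide] child, and a [Decide] node averages two [Move] nodes. *)
Lemma excess_decide s p w n : run s = Decide p w -> G s <= 2 ^- n.
Proof.
elim: n s p w => [|n IH] s p w sp.
  by rewrite expr0 invr1 (excess_le1 dens01).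
have h b : G (rcons s b) <= 2 ^- n / 2.
  have rb : run (rcons s b) = Move p (rcons w b) by rewrite run_rcons sp.
  have := excess_split dens_split (rcons s b).
  rewrite (@excess_leaf0 (rcons (rcons s b) true) (2 * p - step p (tau (rcons w b)))); last first.
    by rewrite run_rcons rb.
  have /IH : run (rcons (rcons s b) false) = Decide (step p (tau (rcons w b))) (rcons w b).
    by rewrite run_rcons rb.
  by move: (G _) (G _) => *; lra.
have := excess_split dens_split s; have := h false; have := h true.
by rewrite half_exprS; move: (G _) (G _) (G _) => *; lra.
Qed.

Definition target_set : set cantor_space := positive_set dens.

Lemma rel_meas_target s : rel_meas R target_set s = dens s.
Proof.
apply: (rel_meas_positive dens01 dens_split).
apply/eqP; rewrite eq_le (excess_ge0 dens01 dens_split) andbT leNgt.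
apply/negP => g0.
have [n _ /(_ n (leqnn n))] := near_infty_natSinv_expn_lt (PosNum g0).
by rewrite /= div1r ltNge (@excess_decide [::] (1 / 2) [::] n).
Qed.

Lemma target_set_closed : closed target_set.
Proof. exact: positive_set_closed. Qed.

Lemma target_set_meets s : target_set `&` cyl s !=set0 <-> 0 < dens s.
Proof.
split=> [[z [/(_ (size s)) + sz]]|d0]; first by rewrite sz.
apply/set0P/eqP => K0; move: d0; rewrite -rel_meas_target.
by rewrite rel_meas_disjoint ?ltxx.
Qed.

Lemma density_target z (l : R) :
  density_is target_set z l <-> (fun n => dens (restr z n)) @ \oo --> l.
Proof.
rewrite /density_is.
by under eq_fun do rewrite -/(rel_meas R target_set _) rel_meas_target.
Qed.

End Process.

(** * Densities of the constructed set *)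

Section Dynamics.
Variables (R : realType) (tau : seq bool -> R).
Hypothesis tau01 : forall w, 0 < tau w < 1.
Implicit Types (z : cantor_space) (w : nat -> bool) (l : R).

Fixpoint pos w n : R :=
  if n is n'.+1 then step (pos w n') (tau (restr w n)) else 1 / 2.

(** The point that feeds [w] to the machine and never enters a leaf. *)
Definition weave w : cantor_space := fun i => ~~ odd i && w i./2.

Lemma pos01 w n : 0 < pos w n < 1.
Proof.
by elim: n => [|n IH] /=; [apply/andP; split; lra|exact: step_bounds].
Qed.

Lemma run_path z n : (forall i, (i < n)%N -> z i.*2.+1 = false) ->
  let w i := z i.*2 in run tau (restr z n.*2) = Decide (pos w n) (restr w n).
Proof.
move=> + w; elim: n => [//|n IH] zf.
rewrite doubleS !restrS !run_rcons IH; last by move=> i /ltnW; exact: zf.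
by rewrite zf //= (restrS w).
Qed.

Lemma dens_weave w n : dens tau (restr (weave w) n) = pos w n./2.
Proof.
have wf i : weave w i.*2.+1 = false by rewrite /weave /= odd_double.
have ww : (fun i => weave w i.*2) = w.
  by apply/funext => i; rewrite /weave odd_double doubleK.
rewrite -{1}(odd_double_half n) /dens; case: (odd n) => /=.
  by rewrite add1n restrS run_rcons run_path// ww.
by rewrite add0n run_path// ww.
Qed.

Lemma run_leaf_stable z m n p : run tau (restr z m) = Leaf p -> (m <= n)%N ->
  exists q, run tau (restr z n) = Leaf q.
Proof.
move=> zm /subnKC <-; elim: (n - m)%N => [|k [q IH]]; first by rewrite addn0; exists p.
by rewrite addnS restrS run_rcons IH /=; eexists.
Qed.

(** The first 1 at an odd place, if any, sends the machine to a leaf. *)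
Lemma leaf_or_weave z :
  (exists n p, run tau (restr z n) = Leaf p) \/ exists w, z = weave w.
Proof.
case: (pselect (exists i, z i.*2.+1)) => [ez|nz].
  left; case: (ex_minnP ez) => n zn minn.
  have zf i : (i < n)%N -> z i.*2.+1 = false.
    by move=> ilt; apply/negbTE/negP => /minn; rewrite leqNgt ilt.
  exists n.+1.*2; rewrite doubleS !restrS !run_rcons run_path// zn /=.
  by eexists.
right; exists (fun i => z i.*2); apply/funext => i; rewrite /weave.
have := odd_double_half i; case: (odd i) => /= e.
  by rewrite -e; apply/negbTE/negP => h; apply: nz; exists i./2.
by rewrite -[in LHS]e.
Qed.

(* Full moves, of size [radius], cannot occur infinitely often near a limit in (0,1). *)
Lemma cvg_increment_lt_radius (u : nat -> R) l : u @ \oo --> l -> 0 < l < 1 ->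
  \forall n \near \oo, `|u n.+1 - u n| < radius (u n).
Proof.
move=> ul /andP[l0 l1].
(* With [m] the radius of [l] and both terms within [m / 4] of [l], the increment is below [m / 2]
   while the radius is above [3 * m / 4]. *)
have e0 : 0 < Num.min l (1 - l) / 4 by rewrite divr_gt0// lt_min l0 subr_gt0.
have /cvgrPdist_lt/(_ _ e0)[N _ HN] := ul.
exists N => // n /= Nn.
have := HN n Nn; have := HN n.+1 (leqW Nn).
rewrite /= !ltr_norml /radius => /andP[? ?] /andP[? ?].
have := erefl (Num.min l (1 - l)).
have : Num.min l (1 - l) <= l by rewrite ge_min lexx.
have : Num.min l (1 - l) <= 1 - l by rewrite ge_min lexx orbT.
case: (leP (u n) (1 - u n)) => ? ? ? _; apply/andP; split; lra.
Qed.

(** Eventually the moves are shorter than the radius, so they land exactly on their targets. *)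
Lemma pos_limit_target w l : pos w @ \oo --> l -> 0 < l < 1 ->
  (fun n => tau (restr w n)) @ \oo --> l.
Proof.
move=> wl l01; have [N _ HN] := cvg_increment_lt_radius wl l01.
rewrite -cvg_shiftS /=; move: wl; rewrite -cvg_shiftS /=.
apply: cvg_trans; apply: near_eq_cvg; exists N => // n /= Nn.
by rewrite (step_target (HN n Nn)).
Qed.

Lemma density_weave w l :
  density_is (target_set tau) (weave w) l <-> pos w @ \oo --> l.
Proof.
rewrite (density_target tau01).
under eq_fun do rewrite dens_weave.
split=> h.
  rewrite (_ : pos w = (fun n => pos w n./2) \o double); last first.
    by apply/funext => n /=; rewrite doubleK.
  apply: cvg_comp h => //.
  move=> P [N _ NP]; exists N => // n /= Nn; apply: NP.
  by rewrite /= -addnn (leq_trans Nn)// leq_addr.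
rewrite (_ : (fun n => pos w n./2) = pos w \o half)//.
apply: cvg_comp h; move=> P [N _ NP]; exists N.*2 => // n /= Nn; apply: NP => /=.
by rewrite -(doubleK N); exact: half_leq.
Qed.

Lemma density_target_cases z l : density_is (target_set tau) z l ->
  [\/ l = 0, l = 1 |
      0 < l < 1 /\ exists w, (fun n => tau (restr w n)) @ \oo --> l].
Proof.
move=> zl; have := zl; rewrite (density_target tau01) => dl.
have /andP[l0 l1] : 0 <= l <= 1.
  have cd : cvgn (fun n => dens tau (restr z n)) by apply/cvg_ex; exists l.
  rewrite -(cvg_lim (@Rhausdorff R) dl); apply/andP; split.
    by apply: limr_ge => //; apply: nearW => n; case/andP: (dens01 tau01 (restr z n)).
  by apply: limr_le => //; apply: nearW => n; case/andP: (dens01 tau01 (restr z n)).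
move: l0; rewrite le_eqVlt => /orP[/eqP <-|l0]; first exact: Or31.
move: l1; rewrite le_eqVlt => /orP[/eqP ->|l1]; first exact: Or32.
have l01 : 0 < l < 1 by rewrite l0.
apply: Or33; split=> //; case: (leaf_or_weave z) => [[m [p zm]]|[w zw]]; last first.
  by exists w; apply: pos_limit_target => //; apply/density_weave; rewrite -zw.
(* Past a leaf every increment has absolute value equal to the radius, which a limit in (0,1)
   forbids. *)
have [N _ /(_ (maxn m N) (leq_maxr _ _)) /=] := cvg_increment_lt_radius dl l01.
have [q qE] := run_leaf_stable zm (leq_maxl m N).
have := dens01 tau01 (restr z (maxn m N)).
rewrite restrS /dens run_rcons qE /= => /andP[? ?].
have rq : 0 <= radius q by rewrite /radius le_min; apply/andP; split=> //; lra.
case: (z _); rewrite addrAC subrr add0r ?normrN ger0_norm ?ltxx//.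
Qed.

(** A move that is not cut short by the radius lands on [t]; otherwise it travels a full radius
    toward [t], and so enters the [e]-interval around [c] or gains at least [eta]. *)
Lemma step_approach (p t c e eta : R) : `|t - c| <= e -> 0 <= eta <= radius p ->
  (`|step p t - c| <= e \/ `|step p t - c| <= `|p - c| - eta) /\
  (`|p - c| <= e -> `|step p t - c| <= e).
Proof.
rewrite /step; move: (radius p) => r; rewrite ler_norml => /andP[? ?] /andP[? ?].
case: (leP (p + r) t) => ?; case: (leP (p - r)) => ?; split; rewrite ?ler_norml;
 try (by move=> /andP[? ?]; apply/andP; split; lra); try (by left; apply/andP; split; lra).
- case: (leP (p + r) (c - e)) => ?; last by left; apply/andP; split; lra.
  by right; rewrite (@ler0_norm _ (p - c)) ?lerBrDr; [apply/andP; split; lra|lra].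
- case: (leP (p - r) (c + e)) => ?; first by left; apply/andP; split; lra.
  by right; rewrite (@ger0_norm _ (p - c)); [apply/andP; split; lra|lra].
Qed.

Lemma pos_follows_target w c : (fun n => tau (restr w n)) @ \oo --> c -> 0 < c < 1 ->
  pos w @ \oo --> c.
Proof.
move=> wc /andP[c0 c1]; apply/cvgrPdist_le => e0 e0pos.
(* Shrinking the tolerance keeps the whole [e]-interval around [c] inside (0,1). *)
pose e := Num.min e0 (Num.min (c / 2) ((1 - c) / 2)).
have epos : 0 < e by rewrite !lt_min e0pos !divr_gt0//= subr_gt0.
have ee0 : e <= e0 by rewrite ge_min lexx.
have ec : e <= c / 2 by rewrite !ge_min lexx orbT.
have ec1 : e <= (1 - c) / 2 by rewrite !ge_min lexx !orbT.
have /cvgrPdist_le/(_ _ epos)[N _ HN] := wc.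
(* From time [N] on, positions are trapped between [lo] and [hi], where the radius has a positive
   lower bound. *)
pose lo := Num.min (pos w N) (c - e); pose hi := Num.max (pos w N) (c + e).
have /andP[pN0 pN1] := pos01 w N.
have lo0 : 0 < lo by rewrite lt_min pN0; lra.
have hi1 : hi < 1 by rewrite gt_max pN1; lra.
have tc k : `|tau (restr w (N + k).+1) - c| <= e.
  by rewrite distrC; apply: HN => /=; rewrite -addnS leq_addr.
have rad p : lo <= p <= hi -> Num.min lo (1 - hi) <= radius p.
  move=> /andP[h1 h2]; rewrite /radius le_min; apply/andP; split; rewrite ge_min; apply/orP.
    by left.
  by right; rewrite lerD2l lerN2.
have eta0 : 0 < Num.min lo (1 - hi) by rewrite lt_min lo0 subr_gt0.
have btw k : lo <= pos w (N + k) <= hi.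
  elim: k => [|k IH]; first by rewrite addn0 ge_min lexx le_max lexx.
  rewrite addnS /=; apply: step_between => //.
    have := tc k; rewrite ler_norml ge_min le_max => /andP[? ?].
    by apply/andP; split; apply/orP; right; lra.
  exact: le_trans (ltW eta0) (rad _ IH).
pose eta := Num.min lo (1 - hi).
(* The initial distance is below 1 and drops by [eta] per move until it is at most [e], where it
   stays. *)
have appr k : `|pos w (N + k) - c| <= e \/ `|pos w (N + k) - c| <= 1 - k%:R * eta.
  elim: k => [|k IH].
    right; rewrite addn0 mul0r subr0 ler_norml; apply/andP; split; lra.
  have e01 : 0 <= eta <= radius (pos w (N + k)) by rewrite ltW//= rad.
  have [H1 H2] := step_approach (tc k) e01.
  rewrite addnS /=; case: IH => IH; first by left; exact: H2.
  case: H1 => H1; [by left|right].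
  by apply: le_trans H1 _; rewrite -natr1; lra.
have [K HK] : exists K : nat, 1 < K%:R * eta.
  exists (Num.bound (1 / eta)); rewrite -ltr_pdivrMr//.
  by rewrite archi_boundP// divr_ge0// ltW.
exists (N + K)%N => // n /= Nn; rewrite distrC.
have -> : n = (N + (n - N))%N by rewrite subnKC// (leq_trans _ Nn)// leq_addr.
case: (appr (n - N)%N) => h; first exact: le_trans h ee0.
exfalso; have : 0 <= 1 - (n - N)%:R * eta by exact: le_trans (normr_ge0 _) h.
have : K%:R * eta <= (n - N)%:R * eta.
  apply: ler_wpM2r; first exact: ltW.
  by rewrite ler_nat leq_subRL// (leq_trans _ Nn)// leq_addr.
by move: (_ * eta) (_ * eta) HK => *; lra.
Qed.

Lemma density_target_limit w c : (fun n => tau (restr w n)) @ \oo --> c -> 0 < c < 1 ->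
  ran_density (target_set tau) c.
Proof.
by move=> wc c01; exists (weave w); apply/density_weave; exact: pos_follows_target.
Qed.

(* [pos] starts at 1/2, so the first move reaches its target [t] and the node 01 is a leaf of
   density [1 - t] in (0,1); always moving in one direction from there ends at 0 or at 1. *)
Lemma density_target_extreme (b : bool) : ran_density (target_set tau) ((~~ b)%:R : R).
Proof.
(* The default value of [nth] makes this the point 0, 1, [b], [b], and so on. *)
pose z : cantor_space := nth b [:: false; true].
pose p : R := 2 * (1 / 2) - step (1 / 2) (tau [:: false]).
have p01 : 0 < p < 1.
  have /step_bounds/(_ (tau01 [:: false])) : 0 < (1 / 2 : R) < 1 by apply/andP; split; lra.
  by rewrite /p => /andP[? ?]; apply/andP; split; lra.
(* Distance from the endpoint being left. A full move doubles it or brings it to 1, so growth by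
   [far p] per move is a safe lower bound. *)
pose far (q : R) := if b then 1 - q else q.
have far0 : 0 < far p by rewrite /far; move: p01 => /andP[? ?]; case: (b); lra.
have H n : exists q, [/\ run tau (restr z n.+2) = Leaf q, far q <= 1 &
    far q = 1 \/ n.+1%:R * far p <= far q].
  elim: n => [|n [q [qE q1 IH]]].
    exists p; split=> //; last by right; rewrite mul1r.
    by rewrite /far; move: p01 => /andP[? ?]; case: (b); lra.
  have zb : z n.+2 = b by rewrite /z /= nth_nil.
  rewrite restrS run_rcons qE zb /=.
  exists (if b then q - radius q else q + radius q); split=> //.
    by move: q1; rewrite /far /radius; case: (b); case: (leP q (1 - q)) => *; lra.
  have n0 : 0 <= n.+1%:R * far p by apply: mulr_ge0 => //; exact: ltW.
  have pn : far p <= n.+1%:R * far p by apply: ler_peMl; [exact: ltW|rewrite ler1n].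
  have -> : n.+2%:R * far p = n.+1%:R * far p + far p.
    by rewrite -(natr1 n.+1) mulrDl mul1r.
  move: q1 IH far0 n0 pn; rewrite /radius; move: (n.+1%:R * far p) => a.
  rewrite /far.
  case: (b); case: (leP q (1 - q)) => ? ? [h|h] ? ? ?;
    try (by left; lra); try (by right; lra).
have [M HM] : exists M : nat, 1 < M%:R * far p.
  exists (Num.bound (1 / far p)); rewrite -ltr_pdivrMr//.
  by apply: archi_boundP; apply: divr_ge0 => //; exact: ltW.
exists z; apply/(density_target tau01).
apply: cvg_near_cst; exists M.+2 => // -[|[|n]]//= Mn.
have [q [qE q1 Hq]] := H n; rewrite /dens qE /=.
have {Hq} : far q = 1.
  case: Hq => // h; have : M%:R * far p <= n.+1%:R * far p.
    by apply: ler_wpM2r; [exact: ltW|rewrite ler_nat; exact: ltnW].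
  by lra.
by rewrite /far; case: (b) => /= h; lra.
Qed.

End Dynamics.

(** * Coding the two trees *)

Section BranchValues.
Variables (R : realType) (U : set (seq nat)) (c : baire_space -> R).
Hypothesis U_pruned : pruned_tree U.

Lemma pruned_extend u : U u -> exists m, U (rcons u m).
Proof.
have [_ Ucl Uext] := U_pruned.
move=> /Uext[[|m t] [//_ Ut]]; exists m; apply: (Ucl _ t).
by rewrite cat_rcons.
Qed.

Lemma pruned_branch u : U u -> exists2 x : nat -> nat, body U x & restr x (size u) = u.
Proof.
move=> Uu; have [_ Ucl _] := U_pruned.
have /choice[f fE] : forall t, exists m, U t -> U (rcons t m).
  by move=> t; case: (pselect (U t)) => [/pruned_extend[m]|nt]; [exists m|exists 0%N].
pose g n := iter n (fun t => rcons t (f t)) u.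
have gU n : U (g n) by elim: n => [//|n IH] /=; exact: fE.
have gsz n : size (g n) = (size u + n)%N.
  by elim: n => [|n IH]; rewrite ?addn0//= size_rcons IH addnS.
have gtake m n : (m <= n)%N -> take (size u + m) (g n) = g m.
  move=> /subnKC <-; elim: (n - m)%N => [|k IH]; first by rewrite addn0 -gsz take_size.
  by rewrite addnS /= -cats1 takel_cat ?IH// gsz leq_add2l leq_addr.
(* The index [i.+1] ensures that position [i] exists even when [u] is empty. *)
pose x i := nth 0%N (g i.+1) i.
have xg n : restr x (size u + n) = g n.
  apply: (@eq_from_nth _ 0%N); rewrite size_restr ?gsz// => i il.
  rewrite /restr nth_mkseq// /x.
  case: (leqP i.+1 n) => h.
    by rewrite -(gtake _ _ h) nth_take// addnS ltnS leq_addl.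
  by rewrite -(gtake _ _ (ltnW h)) nth_take.
exists x; last by have := xg 0%N; rewrite addn0.
move=> n; apply: (Ucl _ (drop n (restr x (size u + n)))).
by rewrite -(restr_take x (leq_addl (size u) n)) cat_take_drop xg.
Qed.

Hypothesis c01 : forall x : baire_space, body U x -> 0 < c x < 1.
Hypothesis c_cont : {within (body U : set baire_space), continuous c}.

(** [a u] is [c] at a chosen branch through [u], and 1/2 off [U]. The branches chosen for the
    prefixes of [x] converge to [x], so continuity of [c] applies. *)
Lemma prefix_values : exists a : seq nat -> R, (forall u, 0 < a u < 1) /\
  (forall x : baire_space, body U x -> (fun n => a (restr x n)) @ \oo --> c x).
Proof.
have /choice[e eE] : forall u, exists x : baire_space,
    U u -> body U x /\ restr x (size u) = u.
  move=> u; case: (pselect (U u)) => [/pruned_branch[x]|nu]; first by exists x.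
  by exists (fun=> 0%N).
exists (fun u => if pselect (U u) then c (e u) else 1 / 2); split=> [u /=|x Ux].
  case: pselect => [/eE[/c01]//|nU /=]; apply/andP; split; lra.
have := c_cont; rewrite subspace_continuousP => /(_ x Ux) cx.
apply/cvgrPdist_lt => r r0.
have /cvgrPdist_lt/(_ r r0) := cx; rewrite near_withinE => /nbhs_restr[].
  exact: discrete_set1.
move=> n Hn; exists n => // k /= nk; case: pselect => [Uk|/(_ (Ux k))//].
have [eU er] := eE _ Uk; apply: Hn => //.
by move: er; rewrite size_restr; exact: restr_le.
Qed.

End BranchValues.

(** * Coding points of Baire space by binary sequences *)

Section Digits.
Implicit Types (x : nat -> nat).

(* Position [pickle (k, i)] of [v] being 1 announces that the [k]-th digit is [i]; only the
   first announcement counts, so that digits read from a finite word are never revised. *)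
Definition digit_at v k p : option nat :=
  if nth false v p then
    if (unpickle p : option (nat * nat)) is Some (k', i)
    then if k' == k then Some i else None else None
  else None.

Definition digit v k : option nat := ohead (pmap (digit_at v k) (iota 0 (size v))).

Definition known v k : bool := all (fun i => isSome (digit v i)) (iota 0 k).

Definition digits v k : seq nat := mkseq (fun i => odflt 0%N (digit v i)) k.

Definition codes (v : nat -> bool) x : Prop :=
  forall k, exists n, digit (restr v n) k = Some (x k).

Lemma digit_stable (v : nat -> bool) k d m n : (m <= n)%N ->
  digit (restr v m) k = Some d -> digit (restr v n) k = Some d.
Proof.
move=> mn; rewrite /digit !size_restr -(subnKC mn) iotaD pmap_cat add0n.
rewrite [in X in _ -> X](@eq_in_pmap _ _ _ (digit_at (restr v m) k) (iota 0 m)); last first.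
  move=> p; rewrite mem_iota add0n /= => pm; rewrite /digit_at /restr !nth_mkseq//.
  by rewrite ltn_addr.
by case: (pmap _ _).
Qed.

Lemma codes_digit v x n k d : codes v x -> digit (restr v n) k = Some d -> d = x k.
Proof.
move=> /(_ k)[m vm] vn; have := digit_stable (leq_maxl m n) vm.
by rewrite (digit_stable (leq_maxr m n) vn) => -[].
Qed.

Lemma codes_digits v x n k : codes v x -> known (restr v n) k ->
  digits (restr v n) k = restr x k.
Proof.
move=> vx /allP kn; apply/eq_in_map => i ik.
have := kn i ik; case e : (digit _ i) => [d|//] _ /=.
exact: codes_digit vx e.
Qed.

Lemma codes_known v x k : codes v x -> exists n, forall m, (n <= m)%N -> known (restr v m) k.
Proof.
move=> vx; elim: k => [|k [n IH]]; first by exists 0%N.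
have [n' vn'] := vx k; exists (maxn n n') => m; rewrite geq_max => /andP[h1 h2].
have := IH m h1; rewrite /known -addn1 iotaD all_cat => -> /=.
by rewrite add0n (digit_stable h2 vn').
Qed.

(** Let [v] announce exactly the correct digits; the first announcement for [k] is then correct, and
    there is one at the code of [(k, x k)]. *)
Lemma codes_surj x : exists v, codes v x.
Proof.
pose v p := if (unpickle p : option (nat * nat)) is Some (k, i) then i == x k else false.
exists v => k; pose p0 := pickle (k, x k); exists p0.+1.
have vp p i : digit_at (restr v p0.+1) k p = Some i -> (p < p0.+1)%N -> i = x k.
  rewrite /digit_at => + pp0; rewrite /restr nth_mkseq// /v.
  case: (unpickle p) => [[k' i']|//]; case: eqP => // ->.
  by case: eqP => // -> [].
have vp0 : digit_at (restr v p0.+1) k p0 = Some (x k).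
  by rewrite /digit_at /restr nth_mkseq// /v /p0 pickleK !eqxx.
rewrite /digit size_restr.
have : x k \in pmap (digit_at (restr v p0.+1) k) (iota 0 p0.+1).
  rewrite mem_pmap -vp0; apply: map_f; rewrite mem_iota /= add0n.
  exact: ltnSn.
case e : (pmap _ _) => [//|d s] _ /=; congr Some.
have : d \in pmap (digit_at (restr v p0.+1) k) (iota 0 p0.+1) by rewrite e mem_head.
rewrite mem_pmap => /mapP[p]; rewrite mem_iota add0n /= => pp0 /esym dp.
exact: vp dp pp0.
Qed.

End Digits.

(** * Targets read off the two trees, and continuity in the binary one *)

Section Coding.
Variables (R : realType) (U : set (seq nat)) (c : baire_space -> R) (a : seq nat -> R).
Hypothesis U_pruned : pruned_tree U.
Hypothesis a01 : forall u, 0 < a u < 1.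
Hypothesis a_cvg : forall x : baire_space, body U x -> (fun n => a (restr x n)) @ \oo --> c x.
Implicit Types (T : tree_space) (x : nat -> nat).

Definition admissible T (s v : seq bool) k : bool :=
  [&& T s, (k <= count id s)%N, known v k & `[< U (digits v k) >]].

(** The range of [k] is large enough, since an admissible [k] is at most the number of ones in [s].
    If [T s] fails, the maximum is over no index and equals 0. *)
Definition level T (s v : seq bool) : nat :=
  \max_(k < (size s).+1 | admissible T s v k) k.

(** Both halves have the same length, and words of lengths [2n] and [2n + 1] with a common prefix
    give the same pair: only the parity in [target] distinguishes them. *)
Definition deinterleave (w : seq bool) (b : bool) : seq bool :=
  mkseq (fun i => nth false w (b + i.*2)) (size w)./2.

Definition target T (w : seq bool) : R :=
  let k := level T (deinterleave w false) (deinterleave w true) in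
  a (digits (deinterleave w true) k) * (1 - (odd (size w))%:R / k.+2%:R).

Lemma U_nil : U [::].
Proof. by have [[u Uu] Ucl _] := U_pruned; exact: (Ucl [::] u). Qed.

Lemma admissible_le T s v j k : (j <= k)%N -> admissible T s v k -> admissible T s v j.
Proof.
move=> jk /and4P[Ts kc kn /asboolP Uk].
rewrite /admissible Ts (leq_trans jk kc) /=; move: kn Uk.
rewrite /known /digits /mkseq -(subnKC jk) iotaD all_cat map_cat => /andP[-> _] /= Uk.
by apply/asboolP; have [_ Ucl _] := U_pruned; exact: Ucl Uk.
Qed.

Lemma admissible_level T s v : T s -> admissible T s v (level T s v).
Proof.
move=> Ts; have a0 : admissible T s v (@ord0 (size s)).
  by rewrite /admissible Ts leq0n; apply/asboolP; exact: U_nil.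
rewrite /level; have [|k ak ->] := @eq_bigmax_cond _
  (fun k : 'I_(size s).+1 => admissible T s v k) (@nat_of_ord _).
  by apply/card_gt0P; exists ord0.
exact: ak.
Qed.

Lemma level_ge T s v k : admissible T s v k -> (k <= level T s v)%N.
Proof.
move=> ak; have ks : (k < (size s).+1)%N.
  by case/and4P: ak => _ /leq_trans h _ _; rewrite ltnS h// count_size.
exact: (@leq_bigmax_cond _ (fun k : 'I_(size s).+1 => admissible T s v k)
  (@nat_of_ord _) (Ordinal ks)).
Qed.

Lemma level_lt T s v k : ~~ admissible T s v k -> (level T s v <= k)%N.
Proof.
move=> nk; apply/bigmax_leqP => j aj; rewrite leqNgt; apply/negP => /ltnW kj.
by move: nk; rewrite (admissible_le kj aj).
Qed.

Lemma level_eq0 T s v : count id s = 0%N -> level T s v = 0%N.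
Proof.
move=> s0; apply/eqP; rewrite -leqn0; apply/bigmax_leqP => j /and4P[_ + _ _].
by rewrite s0.
Qed.

Lemma wobble_bounds (b : bool) k : 1 / 2 <= (1 - b%:R / k.+2%:R : R) <= 1.
Proof.
have k0 : (0 : R) < k.+2%:R by rewrite ltr0n.
have kh : (k.+2%:R^-1 : R) <= 2^-1.
  by rewrite lef_pV2 ?posrE// ler_nat.
have ki : (0 : R) < k.+2%:R^-1 by rewrite invr_gt0.
by move: kh ki; move: (k.+2%:R^-1) => r *; case: b => /=; apply/andP; split; lra.
Qed.

Lemma target01 T w : 0 < target T w < 1.
Proof.
rewrite /target; set k := level _ _ _; set u := digits _ _.
have /andP[h1 h2] := wobble_bounds (odd (size w)) k.
have /andP[a0 a1] := a01 u.
move: (1 - _) h1 h2 => t h1 h2; apply/andP; split; nra.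
Qed.

Lemma deinterleave_restr (w : nat -> bool) b n :
  deinterleave (restr w n) b = restr (fun i => w (b + i.*2)%N) n./2.
Proof.
rewrite /deinterleave size_restr; apply/eq_in_map => i; rewrite mem_iota add0n /= => iN.
rewrite /restr nth_mkseq//.
have : (i.*2.+1 < n)%N.
  rewrite -(odd_double_half n); apply: leq_trans (leq_addl _ _).
  by rewrite -doubleS leq_double.
by case: b => //= /ltnW.
Qed.

Lemma level_unbounded T (y v : nat -> bool) x :
  body [set s | T s] y -> infinitely_many_ones y -> codes v x -> body U x ->
  forall k, exists n, forall m, (n <= m)%N -> (k <= level T (restr y m) (restr v m))%N.
Proof.
move=> Ty y1 vx Ux k.
have [n1 H1] : exists n, forall m, (n <= m)%N -> (k <= count id (restr y m))%N.
  elim: k => [|k [n IH]]; first by exists 0%N.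
  have [n' [nn' yn']] := y1 n; exists n'.+1 => m mn'.
  rewrite /restr -(subnKC mn') /mkseq iotaD map_cat count_cat.
  apply: leq_trans (leq_addr _ _).
  have := IH n' nn'; rewrite -/(mkseq y n'.+1) -/(restr y n'.+1) restrS -cats1 count_cat /=.
  by rewrite yn' addn0 addn1 ltnS.
have [n2 H2] := codes_known k vx.
exists (maxn n1 n2) => m; rewrite geq_max => /andP[m1 m2].
apply: level_ge; apply/and4P; split; [exact: Ty|exact: H1|exact: H2|].
by apply/asboolP; rewrite (codes_digits vx) ?H2//; exact: Ux.
Qed.

(** The level tends to infinity, so the factor [a] tends to [c x] and the alternating factor to
    1. *)
Lemma target_limit T (w : nat -> bool) x :
  body [set s | T s] (fun i => w i.*2) -> infinitely_many_ones (fun i => w i.*2) ->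
  codes (fun i => w i.*2.+1) x -> body U x ->
  (fun n => target T (restr w n)) @ \oo --> c x.
Proof.
set y := fun i => w i.*2; set v := fun i => w i.*2.+1 => Ty y1 vx Ux.
pose k n := level T (restr y n./2) (restr v n./2).
have k_oo K : exists N, forall n, (N <= n)%N -> (K <= k n)%N.
  have [N HN] := level_unbounded Ty y1 vx Ux K.
  by exists N.*2 => n Nn; apply: HN; rewrite -(doubleK N); exact: half_leq.
have kE n : target T (restr w n) = a (restr x (k n)) * (1 - (odd n)%:R / (k n).+2%:R).
  rewrite /target !deinterleave_restr size_restr -/(k n) (codes_digits vx)//.
  by have /and4P[] := admissible_level (restr v n./2) (Ty n./2).
under eq_fun do rewrite kE.
rewrite -[c x]mulr1; apply: cvgM.
  apply: (@cvg_comp _ _ _ k (fun n => a (restr x n)) \oo \oo); last exact: a_cvg.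
  by move=> P [K _ HK]; have [N HN] := k_oo K; exists N => // n /= /HN; exact: HK.
rewrite -[X in _ --> X]subr0; apply: cvgB; first exact: cvg_cst.
apply/cvgrPdist_lt => e e0; pose K := Num.bound (1 / e).
have [N HN] := k_oo K; exists N => // n /= Nn.
rewrite sub0r normrN ger0_norm ?divr_ge0//.
have k0 : (0 : R) < (k n).+2%:R by rewrite ltr0n.
rewrite ltr_pdivrMr//.
have : 1 / e < K%:R by apply: archi_boundP; rewrite divr_ge0// ltW.
rewrite ltr_pdivrMr// => He.
have KK : (K%:R : R) <= (k n).+2%:R by rewrite ler_nat !leqW// HN.
have : (odd n)%:R <= (1 : R) by case: (odd n).
by move: He KK k0; move: (K%:R : R) ((k n).+2%:R : R) ((odd n)%:R : R) => *; nra.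
Qed.

(** If every [k] becomes admissible, [w] codes the two branches and the limit is known. Otherwise
    the level is at most some [K], and the alternation yields [l <= l * (1 - 1/(K+2))], impossible
    for positive [l]. *)
Lemma target_limit_inv T (w : nat -> bool) (l : R) :
  PrTr2 T -> (fun n => target T (restr w n)) @ \oo --> l -> 0 < l ->
  body [set s | T s] `&` calN !=set0 /\ exists2 x, body U x & l = c x.
Proof.
move=> [_ Tcl _] wl l0.
set y := fun i => w i.*2; set v := fun i => w i.*2.+1.
case: (pselect (forall k, exists n, admissible T (restr y n) (restr v n) k)) => [adm|].
  have Ty : body [set s | T s] y.
    move=> n; have [m /and4P[Tm + _ _]] := adm n.
    move=> /leq_trans/(_ (count_size _ _)); rewrite size_restr => nm.
    by apply: (Tcl _ (drop n (restr y m))); rewrite -(restr_take y nm) cat_take_drop.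
  have y1 : infinitely_many_ones y.
    (* [m + 1] ones do not fit in the first [m] positions, so one occurs at [m] or later. *)
    move=> m; have [n /and4P[_ mc _ _]] := adm m.+1.
    apply: contrapT => /forallNP ny; move: mc; rewrite leqNgt ltnS => /negP; apply.
    have [nm|mn] := leqP n m.
      by apply: leq_trans (count_size _ _) _; rewrite size_restr.
    rewrite /restr -(subnKC (ltnW mn)) /mkseq iotaD map_cat count_cat.
    rewrite [X in (_ + X)%N](_ : _ = 0%N) ?addn0.
      by apply: leq_trans (count_size _ _) _; rewrite size_map size_iota.
    apply/eqP; rewrite -leqn0 leqNgt -has_count; apply/negP => /hasP[b /mapP[i]].
    rewrite mem_iota add0n => /andP[mi _] -> yi.
    by apply: (ny i); split.
  have /choice[x vx] : forall k, exists d, exists n, digit (restr v n) k = Some d.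
    move=> k; have [n /and4P[_ _ /allP/(_ k) + _]] := adm k.+1.
    rewrite mem_iota /= add0n leqnn => /(_ isT).
    by case e : (digit _ k) => [d|//] _; exists d, n.
  have Ux : body U x.
    move=> k; have [n /and4P[_ _ kn /asboolP]] := adm k.
    by rewrite (codes_digits vx kn).
  split; first by exists y.
  exists x => //; apply: (cvg_unique (@Rhausdorff R) wl).
  exact: target_limit.
move=> /existsNP[K /forallNP nadm]; exfalso.
have lK n : (level T (restr y n) (restr v n) <= K)%N by apply: level_lt; exact/negP.
have even_l : (fun n => target T (restr w n.*2)) @ \oo --> l.
  apply: (@cvg_comp _ _ _ double (fun n => target T (restr w n)) \oo \oo) => //.
  move=> P [N _ HN]; exists N => // n /= Nn; apply: HN.
  by rewrite /= -addnn (leq_trans Nn)// leq_addr.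
have odd_l : (fun n => target T (restr w n.*2.+1)) @ \oo --> l.
  apply: (@cvg_comp _ _ _ (fun n => n.*2.+1) (fun n => target T (restr w n)) \oo \oo) => //.
  move=> P [N _ HN]; exists N => // n /= Nn; apply: HN.
  by rewrite /= -addnn -addnS (leq_trans Nn)// leq_addr.
have K0 : (0 : R) < K.+2%:R^-1 by rewrite invr_gt0 ltr0n.
have le n : target T (restr w n.*2.+1) <= target T (restr w n.*2) * (1 - K.+2%:R^-1).
  rewrite /target !deinterleave_restr !size_restr /= odd_double /= uphalf_double doubleK.
  rewrite mul0r subr0 mulr1 mul1r.
  set k := level _ _ _; have /andP[a0 _] := a01 (digits (restr (fun i => w (true + i.*2)%N) n) k).
  apply: ler_wpM2l; first exact: ltW.
  rewrite lerD2l lerN2 lef_pV2 ?posrE ?ltr0n// ler_nat !ltnS.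
  exact: lK.
have bound_l : (fun n => target T (restr w n.*2) * (1 - K.+2%:R^-1)) @ \oo --> l * (1 - K.+2%:R^-1).
  by apply: cvgM => //; exact: cvg_cst.
have : l <= l * (1 - K.+2%:R^-1) by apply: (ler_cvg_to odd_l bound_l); exact: nearW le.
by rewrite mulrBr mulr1; have := mulr_gt0 l0 K0; move: (l * _) => *; lra.
Qed.

(** A target consults [T] at a single node, so it is locally constant in [T]. *)
Lemma target_near T w : \forall T' \near T, target T' w = target T w.
Proof.
apply: filterS (near_coord (deinterleave w false) T) => T' TT'.
have levE : level T' (deinterleave w false) (deinterleave w true)
          = level T (deinterleave w false) (deinterleave w true).
  by apply: eq_bigl => k; rewrite /admissible TT'.
by rewrite /target levE.
Qed.

Lemma dens_near T s : \forall T' \near T, dens (target T') s = dens (target T) s.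
Proof.
suff : \forall T' \near T, run (target T') s = run (target T) s.
  by apply: filterS => T'; rewrite /dens => ->.
elim/last_ind: s => [|s b IH]; first exact: filterE.
case e : (run (target T) s) IH => [p|p w|p w] IH.
- by apply: filterS IH => T'; rewrite !run_rcons e => ->.
- by apply: filterS IH => T'; rewrite !run_rcons e => ->.
- by apply: filterS2 IH (target_near T w) => T'; rewrite !run_rcons e => -> /= ->.
Qed.

(** Each density is locally constant in [T]. Inclusion in [V] persists because nodes of density 0
    exclude the points of the compact complement; meeting [V] persists because a node of positive
    density is always met. *)
Lemma target_set_continuous : continuous_PrTr2_to_K (fun T => target_set (target T)).
Proof.
have tc T : closed (target_set (target T)) by exact: target_set_closed.
split=> [T _|W [V [Vo WV]]]; first exact: closed_compact.
exists ((fun T => target_set (target T)) @^-1` W); split=> //.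
rewrite openE => T /=; case: WV => -> /=.
  move=> TV; have /compact_near_coveringP : compact (~` V).
    by apply: closed_compact; exact: open_closedC.
  move=> cV; have : \forall T' \near T, ~` V `<=` (fun z => ~ target_set (target T') z).
    apply: (cV _ (nbhs T) (fun T' z => ~ target_set (target T') z)) => z nVz.
    have /existsNP[n /negP nz] : ~ target_set (target T) z by move=> /TV.
    exists (cyl (restr z n), [set T' | dens (target T') (restr z n) = dens (target T) (restr z n)]).
      by split; [exact: nbhs_cyl|exact: dens_near].
    move=> [z' T'] /= [zz' TT'] /(_ n); apply/negP.
    by move: zz'; rewrite /cyl /= size_restr => ->; rewrite TT'.
  by apply: filterS => T' nK z Kz; apply: contrapT => nVz; exact: nK nVz Kz.
move=> [z [Kz Vz]].
have [n nV] : exists n, forall z' : nat -> bool, restr z' n = restr z n -> V z'.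
  apply: (@nbhs_restr bool z V) => //; first exact: discrete_set1.
  exact: open_nbhs_nbhs.
apply: filterS (dens_near T (restr z n)) => T' TT'.
have : 0 < dens (target T') (restr z n) by rewrite TT'; exact: Kz.
move=> /(target_set_meets (target01 T'))[z' [Kz' zz']]; exists z'; split=> //.
by apply: nV; move: zz'; rewrite /cyl /= size_restr.
Qed.

(** Along the zero point the level is 0, so targets and positions stay away from 0 and 1; a limit
    would lie in (0,1) and yield a branch in [calN]. *)
Lemma target_set_undefined_density T : PrTr2 T ->
  body [set s | T s] `&` calN = set0 ->
  exists z, ~ exists l : R, density_is (target_set (target T)) z l.
Proof.
move=> PT TN; exists (weave (fun=> false)) => -[l /(density_weave (target01 T)) wl].
have t01 := target01 T.
have /andP[a0 a1] := a01 [::].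
(* The interval contains the only possible targets, [a [::]] and its half, as well as the starting
   position 1/2. *)
have tb n : a [::] / 2 <= target T (restr (fun=> false) n) <= (1 + a [::]) / 2.
  rewrite /target !deinterleave_restr.
  rewrite level_eq0; last by rewrite /restr /mkseq; elim: (iota _ _).
  have /andP[] := wobble_bounds (odd (size (restr (fun=> false) n))) 0.
  rewrite /digits /mkseq /=; move: (1 - _) => t ? ?; apply/andP; split; nra.
have pb n : a [::] / 2 <= pos (target T) (fun=> false) n <= (1 + a [::]) / 2.
  elim: n => [|n IH] /=; first by apply/andP; split; lra.
  apply: step_between => //; have /andP[? ?] := pos01 t01 (fun=> false) n.
  by rewrite /radius le_min; apply/andP; split; lra.
have cw : cvgn (pos (target T) (fun=> false)) by apply/cvg_ex; exists l.
have l01 : 0 < l < 1.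
  rewrite -(cvg_lim (@Rhausdorff R) wl); apply/andP; split.
    apply: (@lt_le_trans _ _ (a [::] / 2)); first lra.
    by apply: limr_ge => //; apply: nearW => n; case/andP: (pb n).
  apply: (@le_lt_trans _ _ ((1 + a [::]) / 2)); last lra.
  by apply: limr_le => //; apply: nearW => n; case/andP: (pb n).
have /andP[l0 _] := l01.
have [[y]] := target_limit_inv PT (pos_limit_target wl l01) l0.
by rewrite TN.
Qed.

End Coding.

(** * Ranges of the density in the two cases for the binary tree *)

Unset Implicit Arguments.

Theorem theorem4p3 (R : realType) (U : set (seq nat)) (c : baire_space -> R) :
  pruned_tree U ->
  (forall x : baire_space, body U x -> 0 < c x < 1) ->
  {within (body U : set baire_space), continuous c} ->
  exists H : tree_space -> set cantor_space,
    continuous_PrTr2_to_K H /\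
    (forall T : tree_space, PrTr2 T ->
       (WF2 T -> @spongy R (H T)) /\
       (IF2 T -> @ran_density R (H T) =
                   (c @` (body U : set baire_space)) `|` [set l | l = 0 \/ l = 1])).
Proof.
move=> U_pruned c01 c_cont.
have [a [a01 a_cvg]] := prefix_values U_pruned c01 c_cont.
exists (fun T => target_set (target U a T)); split; first exact: target_set_continuous.
move=> T PT; have t01 := target01 U a01 T.
split=> [[_ TN]|[_ [y [Ty y1]]]].
  split; first exact: (target_set_undefined_density U_pruned a01 a_cvg PT TN).
  move=> z l /(density_target_cases t01)[->|->|[/andP[l0 _] [w wl]]]; [by left|by right|].
  have [[y]] := target_limit_inv U_pruned a01 a_cvg PT wl l0.
  by rewrite TN.
apply/seteqP; split=> l.
  move=> [z /(density_target_cases t01)[->|->|[/andP[l0 _] [w wl]]]].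
  - by right; left.
  - by right; right.
  have [_ [x Ux ->]] := target_limit_inv U_pruned a01 a_cvg PT wl l0.
  by left; exists x.
case=> [[x Ux <-]|[->|->]]; last 2 first.
- exact: (density_target_extreme t01 true).
- exact: (density_target_extreme t01 false).
have [v vx] := codes_surj x.
(* Interleaving the branch [y] with a code [v] of [x] makes the targets converge to [c x]. *)
pose w i := if odd i then v i./2 else y i./2.
have wy : (fun i => w i.*2) = y by apply/funext => i; rewrite /w odd_double doubleK.
have wv : (fun i => w i.*2.+1) = v by apply/funext => i; rewrite /w /= odd_double uphalf_double.
apply: (density_target_limit t01 (w := w)); last exact: c01.
by apply: target_limit => //; rewrite ?wy ?wv.
Qed.
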